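(* Work in Hilbert's classical $\epsilon$-$\tau$ calculus over a language $\mathcal{L}$. Let $S$ and $P$ be unary predicates, i.e. formulas $S(x)$, $P(x)$ of the calculus with no free variable other than $x$. Suppose that $P$ is bivalent with respect to $S$, i.e. that $$P(\epsilon_x S(x))\vdash P(\tau_x S(x))\quad\text{or}\quad P(\tau_x S(x))\vdash P(\epsilon_x S(x)).$$ Then at least one of the two quadruples $\mathcal{S}(S,P)$ and $\mathcal{S}(S,\neg P)$ is a square of opposition, where for unary predicates $S,Q$ the quadruple $\mathcal{S}(S,Q)=(A_{S,Q},E_{S,Q},I_{S,Q},O_{S,Q})$ is given by $$A_{S,Q}=Q(\tau_x S(x)),\quad E_{S,Q}=\neg Q(\epsilon_x S(x)),\quad I_{S,Q}=Q(\epsilon_x S(x)),\quad O_{S,Q}=\neg Q(\tau_x S(x)).$$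
   Context: **The $\epsilon$-$\tau$ calculus.** Let $\mathcal{L}$ be a first-order language. Terms and formulas are defined by mutual recursion. Constants and variables of $\mathcal{L}$ are terms. $f(t_1,\dots,t_p)$ is a term if $f$ is a function symbol of arity $p$ and the $t_i$ are terms. If $A$ is a formula and $x$ a variable, then $\epsilon_x A$ and $\tau_x A$ are terms, in which all free occurrences of $x$ in $A$ are bound. $s=t$ is a formula for terms $s,t$. $R(t_1,\dots,t_n)$ is a formula for a relation symbol $R$ of arity $n$ and terms $t_i$. $A\,\&\,B$, $A\lor B$, $A\Rightarrow B$, $\neg A$ are formulas when $A,B$ are. There are no other quantifiers. $\top$ and $\bot$ denote truth and falsity. For a formula $F(x)$ and a term $t$, $F(t)$ is the result of capture-avoiding substitution of $t$ for $x$. **Derivability.** The deduction rules are those of classical propositional logic with the usual rules of equality, together with: - from a proof of $F(x)$ whose hypotheses contain no free occurrence of $x$, infer $F(\tau_x F(x))$; - from $F(\tau_x F(x))$ infer $F(t)$, for any term $t$; - from $F(t)$, for any term $t$, infer $F(\epsilon_x F(x))$; - the identification $\epsilon_x F(x)=\tau_x \neg F(x)$. Thus $F(\epsilon_x F(x))$ plays the role of $\exists x\,F(x)$ and $F(\tau_x F(x))$ the role of $\forall x\,F(x)$. $X\vdash Y$ means that $Y$ is derivable from the hypothesis $X$ in this calculus (with no non-logical axioms), and $X\dashv\vdash Y$ means $X\vdash Y$ and $Y\vdash X$. **Square of opposition.** A quadruple of formulas $A,E,I,O$ is a square of opposition if: (i) $A\dashv\vdash\neg O$ and $E\dashv\vdash\neg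 I$; (ii) it is not the case that both $\top\vdash A$ and $\top\vdash E$; (iii) it is not the case that both $I\vdash\bot$ and $O\vdash\bot$; (iv) $A\vdash I$ and $E\vdash O$. For a unary predicate $P$, $\neg P$ denotes the unary predicate $\neg P(x)$. *)

(* Defs.v *)
From Stdlib Require Import List.
From Stdlib Require Vector.
Import ListNotations.

Set Implicit Arguments.

Record language := Language {
  const : Type;
  func : Type;
  func_arity : func -> nat;
  rel : Type;
  rel_arity : rel -> nat
}.

(** Expressions are represented up to renaming of bound variables, with de
    Bruijn indices: [Eps A] and [Tau A] bind index [0] of [A], and an index [n]
    that points beyond all the enclosing binders is a free variable.  A formula
    [F(x)] with a distinguished variable [x] is a formula in which [x] is the
    index [0], so that [Eps F] is the term "epsilon_x F(x)". *)
Inductive term (L : language) : Type :=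
| Var : nat -> term L
| Const : const L -> term L
| Fun : forall f : func L, Vector.t (term L) (func_arity L f) -> term L
| Eps : formula L -> term L
| Tau : formula L -> term L
with formula (L : language) : Type :=
| Top : formula L
| Bot : formula L
| Eq : term L -> term L -> formula L
| Rel : forall r : rel L, Vector.t (term L) (rel_arity L r) -> formula L
| And : formula L -> formula L -> formula L
| Or : formula L -> formula L -> formula L
| Imp : formula L -> formula L -> formula L
| Not : formula L -> formula L.

Arguments Var {L} n.
Arguments Const {L} c.
Arguments Fun {L} f ts.
Arguments Top {L}.
Arguments Bot {L}.
Arguments Rel {L} r ts.

Inductive free_in_term (L : language) : nat -> term L -> Prop :=
| free_Var n : free_in_term n (Var n)
| free_Fun n f ts t : Vector.In t ts -> free_in_term n t -> free_in_term n (Fun f ts)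
| free_Eps n A : free_in (S n) A -> free_in_term n (Eps A)
| free_Tau n A : free_in (S n) A -> free_in_term n (Tau A)
with free_in (L : language) : nat -> formula L -> Prop :=
| free_Eq_l n s t : free_in_term n s -> free_in n (Eq s t)
| free_Eq_r n s t : free_in_term n t -> free_in n (Eq s t)
| free_Rel n r ts t : Vector.In t ts -> free_in_term n t -> free_in n (Rel r ts)
| free_And_l n A B : free_in n A -> free_in n (And A B)
| free_And_r n A B : free_in n B -> free_in n (And A B)
| free_Or_l n A B : free_in n A -> free_in n (Or A B)
| free_Or_r n A B : free_in n B -> free_in n (Or A B)
| free_Imp_l n A B : free_in n A -> free_in n (Imp A B)
| free_Imp_r n A B : free_in n B -> free_in n (Imp A B)
| free_Not n A : free_in n A -> free_in n (Not A).

Definition unary_predicate (L : language) (F : formula L) : Prop :=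
  forall n, free_in n F -> n = 0.

Definition scons (X : Type) (x : X) (s : nat -> X) (n : nat) : X :=
  match n with 0 => x | S m => s m end.

Fixpoint rename_term (L : language) (r : nat -> nat) (t : term L) : term L :=
  match t with
  | Var n => Var (r n)
  | Const c => Const c
  | Fun f ts => Fun f (Vector.map (rename_term r) ts)
  | Eps A => Eps (rename (scons 0 (fun n => S (r n))) A)
  | Tau A => Tau (rename (scons 0 (fun n => S (r n))) A)
  end
with rename (L : language) (r : nat -> nat) (A : formula L) : formula L :=
  match A with
  | Top => Top
  | Bot => Bot
  | Eq s t => Eq (rename_term r s) (rename_term r t)
  | Rel R ts => Rel R (Vector.map (rename_term r) ts)
  | And A B => And (rename r A) (rename r B)
  | Or A B => Or (rename r A) (rename r B)
  | Imp A B => Imp (rename r A) (rename r B)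
  | Not A => Not (rename r A)
  end.

(** Extension of a substitution under a binder; the shift is what avoids
    capture. *)
Definition up (L : language) (s : nat -> term L) : nat -> term L :=
  scons (Var 0) (fun n => rename_term S (s n)).

Fixpoint subst_term (L : language) (s : nat -> term L) (t : term L) : term L :=
  match t with
  | Var n => s n
  | Const c => Const c
  | Fun f ts => Fun f (Vector.map (subst_term s) ts)
  | Eps A => Eps (subst (up s) A)
  | Tau A => Tau (subst (up s) A)
  end
with subst (L : language) (s : nat -> term L) (A : formula L) : formula L :=
  match A with
  | Top => Top
  | Bot => Bot
  | Eq t u => Eq (subst_term s t) (subst_term s u)
  | Rel R ts => Rel R (Vector.map (subst_term s) ts)
  | And A B => And (subst s A) (subst s B)
  | Or A B => Or (subst s A) (subst s B)
  | Imp A B => Imp (subst s A) (subst s B)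
  | Not A => Not (subst s A)
  end.

(** [inst F t] is "F(t)": index [0] of [F] is replaced by [t], and the other
    free variables are lowered by one since the variable [x] disappears. *)
Definition inst (L : language) (F : formula L) (t : term L) : formula L :=
  subst (scons t Var) F.

(** Replaces every "epsilon_x F" by "tau_x (not F)". *)
Fixpoint eps_to_tau_term (L : language) (t : term L) : term L :=
  match t with
  | Var n => Var n
  | Const c => Const c
  | Fun f ts => Fun f (Vector.map (@eps_to_tau_term L) ts)
  | Eps A => Tau (Not (eps_to_tau A))
  | Tau A => Tau (eps_to_tau A)
  end
with eps_to_tau (L : language) (A : formula L) : formula L :=
  match A with
  | Top => Top
  | Bot => Bot
  | Eq s t => Eq (eps_to_tau_term s) (eps_to_tau_term t)
  | Rel R ts => Rel R (Vector.map (@eps_to_tau_term L) ts)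
  | And A B => And (eps_to_tau A) (eps_to_tau B)
  | Or A B => Or (eps_to_tau A) (eps_to_tau B)
  | Imp A B => Imp (eps_to_tau A) (eps_to_tau B)
  | Not A => Not (eps_to_tau A)
  end.

(** Natural deduction; the list holds the undischarged hypotheses.

    In [d_tau_intro] the bound variable "x" is index [0] of [F]; shifting the
    hypotheses says that it has no free occurrence in them.

    [d_ident] is the identification of "epsilon_x F" with "tau_x (not F)" at
    every position of a formula, including under binders.  With [d_refl] it
    yields the equation [Eq (Eps F) (Tau (Not F))]. *)
Inductive derivable (L : language) : list (formula L) -> formula L -> Prop :=
| d_hyp G A : In A G -> derivable G A
| d_top G : derivable G Top
| d_bot_elim G A : derivable G Bot -> derivable G A
| d_and_intro G A B : derivable G A -> derivable G B -> derivable G (And A B)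
| d_and_elim_l G A B : derivable G (And A B) -> derivable G A
| d_and_elim_r G A B : derivable G (And A B) -> derivable G B
| d_or_intro_l G A B : derivable G A -> derivable G (Or A B)
| d_or_intro_r G A B : derivable G B -> derivable G (Or A B)
| d_or_elim G A B C :
    derivable G (Or A B) -> derivable (A :: G) C -> derivable (B :: G) C ->
    derivable G C
| d_imp_intro G A B : derivable (A :: G) B -> derivable G (Imp A B)
| d_imp_elim G A B : derivable G (Imp A B) -> derivable G A -> derivable G B
| d_not_intro G A : derivable (A :: G) Bot -> derivable G (Not A)
| d_not_elim G A : derivable G (Not A) -> derivable G A -> derivable G Bot
| d_classical G A : derivable (Not A :: G) Bot -> derivable G A
| d_refl G t : derivable G (Eq t t)
| d_replace G s t F :
    derivable G (Eq s t) -> derivable G (inst F s) -> derivable G (inst F t)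
| d_tau_intro G F : derivable (map (rename S) G) F -> derivable G (inst F (Tau F))
| d_tau_elim G F t : derivable G (inst F (Tau F)) -> derivable G (inst F t)
| d_eps_intro G F t : derivable G (inst F t) -> derivable G (inst F (Eps F))
| d_ident G A B : eps_to_tau A = eps_to_tau B -> derivable G A -> derivable G B.

Definition entails (L : language) (X Y : formula L) : Prop := derivable [X] Y.

Definition interderivable (L : language) (X Y : formula L) : Prop :=
  entails X Y /\ entails Y X.

Record quadruple (L : language) := Quadruple {
  corner_A : formula L;
  corner_E : formula L;
  corner_I : formula L;
  corner_O : formula L
}.

Definition square_of_opposition (L : language) (q : quadruple L) : Prop :=
  let (A, E, I, O) := q in
  (interderivable A (Not O) /\ interderivable E (Not I)) /\
  ~ (entails Top A /\ entails Top E) /\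
  ~ (entails I Bot /\ entails O Bot) /\
  (entails A I /\ entails E O).

Definition quadruple_of (L : language) (S Q : formula L) : quadruple L := {|
  corner_A := inst Q (Tau S);
  corner_E := Not (inst Q (Eps S));
  corner_I := inst Q (Eps S);
  corner_O := Not (inst Q (Tau S))
|}.

Definition bivalent (L : language) (P S : formula L) : Prop :=
  entails (inst P (Eps S)) (inst P (Tau S)) \/
  entails (inst P (Tau S)) (inst P (Eps S)).

(* Main.v *)
(** Condition (iv) of the square for [Q] says that [Q(tau_x S)] entails
    [Q(eps_x S)], up to contraposition.  Bivalence gives this entailment either
    for [P] or, by contraposition again, for [not P].  Conditions (ii) and (iii)
    then reduce to the consistency of the calculus, which follows from a
    one-point model: there all terms have the same value, so a formula has a
    truth value that does not depend on the terms occurring in it. *)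
From Stdlib Require Import List Bool.
Require Import Defs.
Import ListNotations.

Set Implicit Arguments.

(** The truth value in the one-point model where every relation holds. *)
Fixpoint truth (L : language) (A : formula L) : bool :=
  match A with
  | Top | Eq _ _ | Rel _ _ => true
  | Bot => false
  | And A B => truth A && truth B
  | Or A B => truth A || truth B
  | Imp A B => implb (truth A) (truth B)
  | Not A => negb (truth A)
  end.

(** Plain induction on formulas suffices despite the mutual recursion with terms, since [truth]
    never enters a term. *)
Lemma truth_rename (L : language) (r : nat -> nat) (A : formula L) :
  truth (rename r A) = truth A.
Proof. induction A; simpl; congruence. Qed.

Lemma truth_subst (L : language) (s : nat -> term L) (A : formula L) :
  truth (subst s A) = truth A.
Proof. induction A; simpl; congruence. Qed.

Lemma truth_inst (L : language) (F : formula L) (t : term L) :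
  truth (inst F t) = truth F.
Proof. apply truth_subst. Qed.

Lemma truth_eps_to_tau (L : language) (A : formula L) :
  truth (eps_to_tau A) = truth A.
Proof. induction A; simpl; congruence. Qed.

(** Soundness for the one-point model. By [truth_inst], in replacement, [d_tau_elim] and
    [d_eps_intro] the instance of [F] in the premise and the one in the conclusion both have the
    truth value of [F]. *)
Lemma derivable_truth (L : language) (G : list (formula L)) (A : formula L) :
  derivable G A -> (forall B, In B G -> truth B = true) -> truth A = true.
Proof.
  assert (cons_true : forall (G : list (formula L)) A,
    (forall B, In B G -> truth B = true) -> truth A = true ->
    forall B, In B (A :: G) -> truth B = true).
  { intros G' A' HG HA B [<-|HB]; auto. }
  induction 1; intros HG; simpl in *; rewrite ?truth_inst in *; auto.
  - now specialize (IHderivable HG).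
  - now rewrite IHderivable1, IHderivable2.
  - now apply andb_prop in IHderivable.
  - now apply andb_prop in IHderivable.
  - now rewrite IHderivable.
  - rewrite IHderivable by assumption. apply orb_true_r.
  - destruct (orb_prop _ _ (IHderivable1 HG)); eauto.
  - destruct (truth A) eqn:HA; simpl; eauto.
  - specialize (IHderivable1 HG). now rewrite IHderivable2 in IHderivable1.
  - destruct (truth A) eqn:HA; simpl; eauto.
  - specialize (IHderivable1 HG). now rewrite IHderivable2 in IHderivable1.
  - destruct (truth A) eqn:HA; auto.
    apply IHderivable, cons_true; simpl; now rewrite ?HA.
  (* Rule [d_tau_intro]: shifting the hypotheses keeps their truth values. *)
  - apply IHderivable. intros B HB.
    apply in_map_iff in HB as [C [<- HC]]. rewrite truth_rename; auto.
  (* Rule [d_ident]: both formulas share their truth value with their common image under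
     [eps_to_tau]. *)
  - rewrite <- truth_eps_to_tau, <- H, truth_eps_to_tau; auto.
Qed.

Lemma entails_truth (L : language) (X Y : formula L) :
  entails X Y -> truth X = true -> truth Y = true.
Proof.
  intros H HX. apply (derivable_truth H). now intros B [<-|[]].
Qed.

Lemma derivable_weaken (L : language) (G H : list (formula L)) (A : formula L) :
  derivable G A -> incl G H -> derivable H A.
Proof.
  intros D; revert H.
  assert (incl_cons_cons : forall (B : formula L) G H,
    incl G H -> incl (B :: G) (B :: H)).
  { intros B G1 G2 HG. apply incl_cons; [apply in_eq | now apply incl_tl]. }
  induction D; intros G' HG.
  - apply d_hyp; auto.
  - apply d_top.
  - apply d_bot_elim; auto.
  - apply d_and_intro; auto.
  - apply d_and_elim_l with B; auto.
  - apply d_and_elim_r with A; auto.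
  - apply d_or_intro_l; auto.
  - apply d_or_intro_r; auto.
  - apply d_or_elim with A B; auto.
  - apply d_imp_intro; auto.
  - apply d_imp_elim with A; auto.
  - apply d_not_intro; auto.
  - apply d_not_elim with A; auto.
  - apply d_classical; auto.
  - apply d_refl.
  - apply d_replace with s; auto.
  - apply d_tau_intro, IHD, incl_map, HG.
  - apply d_tau_elim; auto.
  - apply d_eps_intro with t; auto.
  - apply d_ident with A; auto.
Qed.

Lemma entails_contrapositive (L : language) (X Y : formula L) :
  entails X Y -> entails (Not Y) (Not X).
Proof.
  intros H. apply d_not_intro, d_not_elim with Y.
  - apply d_hyp; simpl; auto.
  - apply (derivable_weaken H). intros B [<-|[]]; apply in_eq.
Qed.

Lemma interderivable_double_negation (L : language) (X : formula L) :
  interderivable X (Not (Not X)).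
Proof.
  split.
  - apply d_not_intro, d_not_elim with X; apply d_hyp; simpl; auto.
  - apply d_classical, d_not_elim with (Not X); apply d_hyp; simpl; auto.
Qed.

Lemma square_of_entails (L : language) (S Q : formula L) :
  entails (inst Q (Tau S)) (inst Q (Eps S)) ->
  square_of_opposition (quadruple_of S Q).
Proof.
  intros H. repeat split.
  - apply interderivable_double_negation.
  - apply interderivable_double_negation.
  - apply d_hyp, in_eq.
  - apply d_hyp, in_eq.
  - intros [HA HE].
    (* Condition (ii): [A] and [E] would make [Q] both true and false. *)
    apply entails_truth in HA, HE; try reflexivity.
    simpl in HE. rewrite truth_inst in HA, HE. now rewrite HA in HE.
  - intros [HI HO].
    pose proof (entails_truth HI) as TI. pose proof (entails_truth HO) as TO.
    simpl in TI, TO. rewrite truth_inst in TI, TO.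
    (* Whichever value [Q] has, one of [I] and [O] is true and cannot entail [Bot]. *)
    destruct (truth Q); simpl in *; intuition congruence.
  - exact H.
  - apply entails_contrapositive, H.
Qed.

Theorem proposition3 (L : language) (S P : formula L)
    (hS : unary_predicate S) (hP : unary_predicate P) (hSP : bivalent P S) :
  square_of_opposition (quadruple_of S P) \/
  square_of_opposition (quadruple_of S (Not P)).
Proof.
  destruct hSP as [H|H].
  (* [inst (Not P) t] computes to [Not (inst P t)], so the contrapositive of [H] is the required
     entailment by conversion. *)
  - right. apply square_of_entails, (entails_contrapositive H).
  - left. apply square_of_entails, H.
Qed.
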